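(* Let $\beta>1$ and let $\psi_1,\psi_2:\mathbb{N}\to\mathbb{R}^+$ be positive functions with $\underline{v}_1\ge 0$ and $\underline{v}_2\ge 0$. (1) If $\underline{v}_1=\overline{v}_1=\underline{v}_2=\overline{v}_2=0$, then $\dim_H\left(\mathcal{L}(\psi_1)\cap\mathcal{U}(\psi_2)\right)=1$. (2) If $\underline{v}_2=\infty$ and $0\le\underline{v}_1\le\overline{v}_1\le\infty$, then $\mathcal{L}(\psi_1)\cap\mathcal{U}(\psi_2)$ is countable. (3) If $\underline{v}_1=\infty$ and $0\le\underline{v}_2\le\overline{v}_2\le\infty$, then $\dim_H\left(\mathcal{L}(\psi_1)\cap\mathcal{U}(\psi_2)\right)=0$.
   Context: For $\beta>1$, the $\beta$-transformation is $T_\beta(x)=\beta x-\lfloor\beta x\rfloor$ for $x\in[0,1)$, extended by $T_\beta(1)=\beta-\lfloor\beta\rfloor$; $T_\beta^n$ is its $n$-th iterate ($T_\beta^0 x=x$). For positive functions $\psi_1,\psi_2:\mathbb{N}\to\mathbb{R}^+$ define $$\mathcal{L}(\psi_1)=\{x\in[0,1]: T_\beta^n x<\psi_1(n)\text{ for infinitely many } n\in\mathbb{N}\},$$ $$\mathcal{U}(\psi_2)=\{x\in[0,1]: \text{for all sufficiently large integers } N \text{ there is an integer } n\in[0,N] \text{ with } T_\beta^n x<\psi_2(N)\}.$$ For $i=1,2$ put $$\underline{v}_i=\liminf_{n\to\infty}\frac{-\log_\beta\psi_i(n)}{n},\qquad \overline{v}_i=\limsup_{n\to\infty}\frac{-\log_\beta\psi_i(n)}{n},$$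 which may equal $+\infty$. $\dim_H$ denotes Hausdorff dimension. *)

(* Defs.v *)
From HB Require Import structures.
From mathcomp Require Import all_boot all_order all_algebra.
From mathcomp Require Import all_classical all_reals all_analysis.
Set Implicit Arguments.
Unset Strict Implicit.
Unset Printing Implicit Defensive.
Import Order.TTheory GRing.Theory Num.Theory.
Import numFieldNormedType.Exports.
Local Open Scope classical_set_scope.
Local Open Scope ring_scope.

(* The value at 1 is beta - floor(beta), the usual extension from [0, 1[. *)
Definition beta_map (R : realType) (beta x : R) : R :=
  beta * x - (Num.floor (beta * x))%:~R.

Definition limsup_set (R : realType) (beta : R) (psi : nat -> R) : set R :=
  [set x | x \in `[0, 1] /\
           infinite_set [set n : nat | iter n (beta_map beta) x < psi n]].

Definition uniform_set (R : realType) (beta : R) (psi : nat -> R) : set R :=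
  [set x | x \in `[0, 1] /\
           \forall N \near \oo, exists2 n : nat,
             (n <= N)%N & iter n (beta_map beta) x < psi N].

Definition logb (R : realType) (beta x : R) : R := ln x / ln beta.

(* The junk value at n = 0, where n%:R is not invertible, does not affect the
   lower and upper limits below. *)
Definition decay_rate (R : realType) (beta : R) (psi : nat -> R) (n : nat) :
    \bar R :=
  ((- logb beta (psi n)) / n%:R)%:E.

Definition lower_exponent (R : realType) (beta : R) (psi : nat -> R) : \bar R :=
  limn_einf (decay_rate beta psi).

Definition upper_exponent (R : realType) (beta : R) (psi : nat -> R) : \bar R :=
  limn_esup (decay_rate beta psi).

(* Adjoining 0 gives the empty set diameter 0 instead of -oo. *)
Definition diam (R : realType) (U : set R) : \bar R :=
  ereal_sup (0%E |` [set `|p.1 - p.2|%:E | p in U `*` U]).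

(* The empty set is treated apart because 0 `^ 0 = 1: it must contribute 0
   when s = 0, whereas a singleton must contribute 1. *)
Definition diam_pow (R : realType) (s : R) (U : set R) : \bar R :=
  if U == set0 then 0%E else (diam U `^ s)%E.

Definition hausdorff_content (R : realType) (s delta : R) (A : set R) :
    \bar R :=
  ereal_inf [set (\sum_(i <oo) diam_pow s (F i))%E | F in
    [set F : nat -> set R | (forall i, (diam (F i) <= delta%:E)%E) /\
                            A `<=` \bigcup_i F i]].

(* The content is nonincreasing in delta, so its limit as delta tends to 0
   is a supremum. *)
Definition hausdorff_measure (R : realType) (s : R) (A : set R) : \bar R :=
  ereal_sup [set hausdorff_content s delta A | delta in
    [set delta : R | 0 < delta]].

Definition hausdorff_dim (R : realType) (A : set R) : \bar R :=
  ereal_inf [set s%:E | s in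
    [set s : R | 0 <= s /\ hausdorff_measure s A = 0%E]].

(* Main.v *)
Require Import Defs.
From HB Require Import structures.
From mathcomp Require Import all_boot all_order all_algebra.
From mathcomp Require Import all_classical all_reals all_analysis.
From mathcomp Require Import ring lra zify.
Import Order.TTheory GRing.Theory Num.Theory.
Import numFieldNormedType.Exports.
Local Open Scope classical_set_scope.
Local Open Scope ring_scope.

(** Write T for the beta-transformation.

    Fast uniform approximation.  If psi2 decays faster than beta^(-3N), a visit
    T^n x < psi2(N) with n <= N is so close to 0 that the orbit is merely
    multiplied by beta from time n to time N, whence T^N x < beta^(-2N).  When
    this holds for every large N the orbit never wraps around any more, so it
    grows by the factor beta at each step while remaining bounded; it must
    vanish.  Points with a finite expansion are countably many
    ([countable_uniform_set]).

    Fast limsup approximation.  A point with T^n x < psi1(n) lies within psi1(n)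
    to the right of a preimage of 0 of order n, and there are at most M^n such
    preimages, with M = floor(beta) + 1.  When psi1 decays faster than every
    geometric sequence, the sums of the s-th powers of these lengths have
    arbitrarily small tails for every s > 0.

    Subexponential psi1 and psi2.  It suffices to find, for each s < 1, a set of
    positive s-dimensional measure of points x such that T^(m 2^k) x is at most
    beta^(-c m 2^k) for all k, with some constant c > 0
    ([hausdorff_measure_small_orbits]): the visit at time m 2^k serves both the
    limsup set and every N in [m 2^k, m 2^(k+1)) for the uniform set.
    Such points are coded by words.  Call a the left endpoint of a full interval
    of order n when T^n maps [a, a + beta^(-n)) affinely onto [0, 1); words of
    full intervals can be concatenated freely, whatever the restrictions on
    digits are.  Full intervals are numerous: [0, 1) is covered by pieces of
    length at most beta^(-n), at most one for each full interval of order
    i <= n, so that there are at least about beta^n / n full intervals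
    ([many_full]).  Taking these as
    letters, appending a digit 0 to separate them, and forcing the letter 0 on
    a set of positions of small density which contains a run of length about
    2^k / Q at each 2^k, yields a Cantor set.  Reading the free letters as digits
    in base N, the number of letters, gives a map from the Cantor set onto [0, 1)
    that is Hoelder of exponent s; countable subadditivity of Lebesgue measure
    on [0, 1) then bounds the s-dimensional measure from below
    ([holder_parametrization_hausdorff_measure]). *)

(** * Growth of real powers *)

Section RealPowers.
Variable R : realType.
Implicit Types b x y : R.

Lemma exprn_ge_bernoulli b n : 1 <= b -> 1 + n%:R * (b - 1) <= b ^+ n.
Proof.
move=> b1; elim: n => [|n IH]; first by rewrite expr0 mul0r addr0.
rewrite exprS; apply: (@le_trans _ _ (b * (1 + n%:R * (b - 1)))); last first.
  by rewrite ler_wpM2l //; lra.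
have : 0 <= n%:R * (b - 1) ^+ 2 :> R by rewrite mulr_ge0 // sqr_ge0.
rewrite -natr1; nra.
Qed.

Lemma exprn_unbounded b x : 1 < b -> exists n, x < b ^+ n.
Proof.
move=> b1; have b0 : 0 < b - 1 by rewrite subr_gt0.
exists (Num.truncn (x / (b - 1))).+1.
apply: lt_le_trans (exprn_ge_bernoulli _ _ (ltW b1)).
have := truncnS_gt (x / (b - 1)).
by rewrite ltr_pdivrMr // => h; lra.
Qed.

Lemma exprn_powR b x n : 0 <= b -> (b `^ x) ^+ n = (b ^+ n) `^ x.
Proof.
move=> b0; elim: n => [|n IH]; first by rewrite !expr0 powR1.
by rewrite !exprS IH powRM // exprn_ge0.
Qed.

Lemma gt1_ltr_powRr b x y : 1 < b -> (b `^ x < b `^ y) = (x < y).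
Proof.
move=> b1; rewrite /powR gt_eqF ?(lt_trans ltr01 b1) //.
by rewrite ltr_expR ltr_pM2r // ln_gt0.
Qed.

(** Exponential growth beats linear growth: Bernoulli's inequality for the exponent
    [m], once squared, already gives a quadratic lower bound on [b ^+ (2 * m)]. *)
Lemma exprn_gt_linear b x : 1 < b -> exists n, x * n.+1%:R <= b ^+ n.+1.
Proof.
move=> b1; have h0 : 0 < b - 1 by rewrite subr_gt0.
pose m := (Num.truncn (2 * x / (b - 1) ^+ 2)).+1.
have hm : 2 * x < m%:R * (b - 1) ^+ 2.
  by rewrite -ltr_pdivrMr ?exprn_gt0 //; exact: truncnS_gt.
exists (2 * m).-1; rewrite prednK //.
have mh0 : 0 <= m%:R * (b - 1) by rewrite mulr_ge0 // ltW.
apply: (@le_trans _ _ ((m%:R * (b - 1)) ^+ 2)).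
  rewrite natrM mulrA [x * 2]mulrC exprMn [m%:R ^+ 2]expr2 -mulrA [leRHS]mulrC.
  by rewrite ler_wpM2r // ltW.
rewrite mulnC exprM ler_pXn2r ?nnegrE // ?exprn_ge0 ?(ltW (lt_trans _ b1)) //.
by apply: le_trans (exprn_ge_bernoulli b m (ltW b1)); rewrite lerDr.
Qed.
End RealPowers.

(** * Orbits of the beta-transformation *)

Section Iterates.
Variables (R : realType) (beta : R).
Hypothesis beta_gt1 : 1 < beta.
Implicit Types (x y p a : R) (n k : nat).

Let beta_gt0 : 0 < beta. Proof. exact: lt_trans beta_gt1. Qed.

Let betaX_gt0 n : 0 < beta ^+ n. Proof. exact: exprn_gt0. Qed.

Lemma beta_map_ge0_lt1 x : 0 <= beta_map beta x < 1.
Proof.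
have /andP[h1 h2] := floor_itv (beta * x).
move: h2; rewrite /beta_map intrD => h2.
by apply/andP; split; lra.
Qed.

Lemma beta_mapE x k : k%:R <= beta * x < k.+1%:R ->
  beta_map beta x = beta * x - k%:R.
Proof.
move=> h; rewrite /beta_map (@floor_def _ _ k%:Z) //.
by move: h; rewrite intrD -[in k.+1]addn1 natrD.
Qed.

Lemma iter_beta_map_itv n x : x \in `[0, 1] ->
  0 <= iter n (beta_map beta) x <= 1.
Proof.
case: n => [|n]; first by rewrite in_itv.
by move=> _ /=; have /andP[-> /ltW ->] := beta_map_ge0_lt1 (iter n (beta_map beta) x).
Qed.

(** No wrapping occurs before the orbit of [x] reaches 1, so the iterates are
    plain multiplications. *)
Lemma iter_beta_map_small n x : 0 <= x -> beta ^+ n * x < 1 ->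
  iter n (beta_map beta) x = beta ^+ n * x.
Proof.
move=> x0; elim: n => [|n IH] h; first by rewrite expr0 mul1r.
have hn : beta ^+ n * x < 1.
  apply: le_lt_trans h; by rewrite ler_wpM2r // exprS ler_peMl ?ltW.
rewrite iterS IH // (@beta_mapE _ 0) ?subr0 ?mulrA -?exprS //.
by rewrite h andbT mulr_ge0 // ltW.
Qed.

(** This contains all [x] in [0, 1] with [iter n (beta_map beta) x = 0], but also
    sums of digits that are not admissible, so that its length is a plain power. *)
Fixpoint zero_preimages n : seq R :=
  if n is m.+1 then
    allpairs (fun k p => (k%:R + p) / beta)
      (iota 0 (Num.truncn beta).+1) (zero_preimages m)
  else [:: 0].

Lemma size_zero_preimages n :
  size (zero_preimages n) = ((Num.truncn beta).+1 ^ n)%N.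
Proof.
elim: n => [//|n IH].
by rewrite [LHS]size_allpairs size_iota IH expnS.
Qed.

(** The point [p] is the sum of the first [n] terms of the greedy expansion
    of [x]. *)
Lemma zero_preimagesP n x : x \in `[0, 1] ->
  exists2 p, p \in zero_preimages n & x = p + iter n (beta_map beta) x / beta ^+ n.
Proof.
elim: n x => [|n IH] x xI.
  by exists 0; rewrite ?inE // expr0 divr1 add0r.
have Tx : beta_map beta x \in `[0, 1].
  by rewrite in_itv /=; have /andP[-> /ltW ->] := beta_map_ge0_lt1 x.
have [p pn Ep] := IH _ Tx.
move: xI; rewrite in_itv /= => /andP[x0 x1].
have bx0 : 0 <= beta * x by rewrite mulr_ge0 // ltW.
exists (((Num.truncn (beta * x))%:R + p) / beta).
  have d_lt : Num.truncn (beta * x) \in iota 0 (Num.truncn beta).+1.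
    by rewrite mem_iota /= add0n ltnS; apply: le_truncn; rewrite ler_piMr // ltW.
  exact: (@allpairs_f _ _ _ (fun k p => (k%:R + p) / beta) _ _ _ _ d_lt pn).
have E : beta_map beta x = beta * x - (Num.truncn (beta * x))%:R.
  by apply: beta_mapE; exact: truncn_itv.
rewrite -iterS iterSr exprS invfM mulrA mulrAC.
have -> : iter n (beta_map beta) (beta_map beta x) / beta ^+ n =
  beta * x - (Num.truncn (beta * x))%:R - p by rewrite -E {2}Ep addrC addKr.
by field; rewrite gt_eqF.
Qed.

(** The exponent 3 leaves a factor to spare: a visit at time [n <= N] below
    [beta ^- (3 * N)] still forces the orbit below [beta ^- (2 * N)] at time [N],
    and an orbit this small at all large times is eventually 0. *)
Lemma countable_uniform_set psi : (\forall N \near \oo, psi N < beta ^- (3 * N)) ->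
  countable (uniform_set beta psi).
Proof.
move=> hpsi.
have cU : countable (\bigcup_n [set` zero_preimages n]).
  by apply: bigcup_countable => // n _; exact/finite_set_countable/finite_seq.
apply: sub_countable cU; apply: subset_card_le => x /= [xI hx].
(* From the visit at time n to time N the orbit is multiplied by beta ^+ (N - n). *)
have [N0 _ hN] : \forall N \near \oo,
    iter N (beta_map beta) x < beta ^- (2 * N).
  near=> N; have [n nN hn] : exists2 n, (n <= N)%N &
      iter n (beta_map beta) x < psi N by near: N.
  have hp : psi N < beta ^- (3 * N) by near: N.
  have /andP[T0 _] := iter_beta_map_itv n x xI.
  have hT : beta ^+ (N - n) * iter n (beta_map beta) x < beta ^- (2 * N).
    apply: (@le_lt_trans _ _ (beta ^+ N * iter n (beta_map beta) x)).
      rewrite ler_wpM2r // ler_eXn2l //; exact: leq_subr.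
    rewrite -ltr_pdivlMl //; apply: lt_trans hn _; apply: lt_le_trans hp _.
    by rewrite -invfM -exprD (_ : (N + 2 * N = 3 * N)%N) //; lia.
  have hT1 : beta ^- (2 * N) <= 1.
    by rewrite invf_le1 // exprn_ege1 // ltW.
  have E := iter_beta_map_small _ _ T0 (lt_le_trans hT hT1).
  by rewrite -E -iterD subnK // in hT.
(* Time N0.+1 rather than N0: one more multiplication by beta must keep the
   orbit below 1, which fails to follow from the bound at time 0. *)
set y := iter N0.+1 (beta_map beta) x.
have y0 : 0 <= y by have /andP[] := iter_beta_map_itv N0.+1 x xI.
have hk k : iter (k + N0.+1) (beta_map beta) x < beta ^- (2 * (k + N0.+1)).
  by apply: hN => /=; lia.
have hy k : iter k (beta_map beta) y = beta ^+ k * y.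
  elim: k => [|k IH]; first by rewrite expr0 mul1r.
  have := hk k; rewrite iterD -/y IH => h.
  rewrite iterS IH (@beta_mapE _ 0) ?subr0 ?mulrA -?exprS //.
  rewrite [X in X && _]mulr_ge0 //=; last exact: ltW.
  rewrite exprS -mulrA -ltr_pdivlMl // mulr1; apply: (lt_le_trans h).
  by rewrite lef_pV2 ?posrE // -[leLHS]expr1 ler_eXn2l //; lia.
have y_eq0 : y = 0.
  apply/eqP; rewrite eq_le y0 andbT leNgt; apply/negP => y_gt0.
  have [k yk] := exprn_unbounded _ _ y^-1 beta_gt1.
  have := hk k; rewrite iterD -/y hy ltNge => /negP; apply.
  apply: (@le_trans _ _ 1); first by rewrite invf_le1 // exprn_ege1 // ltW.
  by rewrite -ler_pdivrMr // mul1r ltW.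
have [p pn Ep] := zero_preimagesP N0.+1 x xI.
have Exp : x = p by rewrite Ep -/y y_eq0 mul0r addr0.
by exists N0.+1 => //; rewrite /mkset Exp.
Unshelve. all: by end_near.
Qed.
End Iterates.

(** * Two criteria for Hausdorff measures *)

Section Hausdorff.
Variable R : realType.
Implicit Types (U A : set R) (s d e : R).

Lemma diam_le U d : 0 <= d -> (forall x y, U x -> U y -> `|x - y| <= d) ->
  (diam U <= d%:E)%E.
Proof.
move=> d0 h; apply: ge_ereal_sup => z [->|[[x y] /= [Ux Uy] <-]].
  by rewrite lee_fin.
by rewrite lee_fin h.
Qed.

Lemma le_diam U x y : U x -> U y -> (`|x - y|%:E <= diam U)%E.
Proof. by move=> Ux Uy; apply: ereal_sup_ubound; right; exists (x, y). Qed.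

Lemma diam_ge0 U : (0 <= diam U)%E.
Proof. by apply: ereal_sup_ubound; left. Qed.

Lemma diam_pow_ge0 s U : (0 <= diam_pow s U)%E.
Proof. by rewrite /diam_pow; case: ifP => // _; exact: poweR_ge0. Qed.

Lemma diam_fineK U d : (diam U <= d%:E)%E -> (fine (diam U))%:E = diam U.
Proof.
move=> h; apply: fineK; rewrite ge0_fin_numE ?diam_ge0 //.
exact: le_lt_trans h (ltry _).
Qed.

Lemma diam_pow_le s U d : 0 <= s -> (diam U <= d%:E)%E ->
  (diam_pow s U <= (d `^ s)%:E)%E.
Proof.
move=> s0 Ud; rewrite /diam_pow; case: ifP => _; first by rewrite lee_fin powR_ge0.
have E := diam_fineK _ _ Ud.
have := Ud; have := diam_ge0 U; rewrite -E poweR_EFin !lee_fin => r0 rd.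
by apply: ge0_ler_powR; rewrite ?nnegrE //; exact: le_trans rd.
Qed.

(** Covers come naturally indexed by a level and a position in that level; a
    bijection between [nat] and [nat * nat] flattens them. *)
Lemma hausdorff_content_le_double s d A (G : nat -> nat -> set R) :
  (forall n j, (diam (G n j) <= d%:E)%E) ->
  A `<=` \bigcup_n \bigcup_j G n j ->
  (hausdorff_content s d A <=
     \sum_(n <oo) \sum_(j <oo) diam_pow s (G n j))%E.
Proof.
move=> Gd AG.
have /card_set_bijP[f bij_f] : ([set: nat] #= [set: nat * nat])%card.
  by rewrite card_eq_sym card_nat2.
apply: (@le_trans _ _ (\sum_(i <oo) diam_pow s (G (f i).1 (f i).2))%E).
  apply: ereal_inf_lbound; exists (fun i => G (f i).1 (f i).2) => //.
  split=> // x /AG[n _ [j _ Gx]].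
  have [_ _ surj_f] := bij_f.
  by have [i _ fi] := surj_f (n, j) I; exists i; rewrite // fi.
rewrite nneseries_esumT; last by move=> *; exact: diam_pow_ge0.
rewrite -(@reindex_esum _ _ _ _ _ f (fun p => diam_pow s (G p.1 p.2)) bij_f).
rewrite nneseries_esumT; last first.
  by move=> *; apply: nneseries_ge0 => *; exact: diam_pow_ge0.
rewrite (eq_esum (b := fun n => \esum_(j in [set: nat]) diam_pow s (G n j))%E); last first.
  by move=> n _; rewrite nneseries_esumT // => *; exact: diam_pow_ge0.
rewrite esum_esum; last by move=> *; exact: diam_pow_ge0.
rewrite (_ : _ `*`` _ = [set: nat * nat]) //.
by apply/seteqP; split => //= -[].
Qed.

Lemma nneseries_bounded_support (c : R) K (a : nat -> \bar R) : 0 <= c ->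
  (forall j, (0 <= a j)%E) -> (forall j, (a j <= if (j < K)%N then c%:E else 0)%E) ->
  (\sum_(j <oo) a j <= (K%:R * c)%:E)%E.
Proof.
move=> c0 a0 ac; apply: lime_le; first exact: is_cvg_nneseries.
apply: nearW => m; apply: (@le_trans _ _ ((minn m K)%:R * c)%:E); last first.
  by rewrite lee_fin ler_wpM2r // ler_nat geq_minr.
elim: m => [|m IH]; first by rewrite big_geq // min0n mul0r.
rewrite big_nat_recr //=.
apply: (le_trans (leeD IH (ac m))).
case: ltnP => mK; rewrite -EFinD lee_fin.
  by rewrite (minn_idPl mK) -natr1 mulrDl mul1r.
by rewrite addr0 (minn_idPr (leqW mK)).
Qed.

(** The costs of the levels are dominated by a geometric series of sum [e], so the
    content vanishes at every scale. A finite number of sets of comparable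
    diameter in each level is the form in which limsup sets are covered. *)
Lemma hausdorff_measure_eq0 s A : 0 < s ->
  (forall e, 0 < e -> exists (K : nat -> nat) (d : nat -> R) (G : nat -> nat -> set R),
    [/\ forall n, 0 <= d n <= e,
        forall n j, (j < K n)%N -> (diam (G n j) <= (d n)%:E)%E,
        forall n, (K n)%:R * d n `^ s <= e / (2 ^ n.+1)%:R &
        A `<=` \bigcup_n \bigcup_(j in `I_(K n)) G n j]) ->
  hausdorff_measure s A = 0%E.
Proof.
move=> s0 hA; apply/eqP; rewrite eq_le; apply/andP; split; last first.
  apply: le_ereal_sup_tmp; exists (hausdorff_content s 1 A); first by exists 1 => /=.
  apply: le_ereal_inf_tmp => z [F _ <-].
  by apply: nneseries_ge0 => *; exact: diam_pow_ge0.
apply: ge_ereal_sup => z [delta /= delta0 <-].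
apply/lee_addgt0Pr => e e0; rewrite add0e.
have m0 : 0 < Num.min e delta by rewrite lt_min e0.
have [K [d [G [hd hG hK hcov]]]] := hA _ m0.
pose G' n j := if (j < K n)%N then G n j else set0.
have diam0 : diam (@set0 R) = 0%E.
  by apply/eqP; rewrite eq_le diam_ge0 andbT diam_le.
apply: (@le_trans _ _ (\sum_(n <oo) \sum_(j <oo) diam_pow s (G' n j))%E).
  apply: hausdorff_content_le_double => [n j|x /hcov[n _ [j /= jK Gx]]].
    rewrite /G'; case: ifP => [jK|_]; last by rewrite diam0 lee_fin ltW.
    apply: (le_trans (hG _ _ jK)); rewrite lee_fin.
    by have /andP[_] := hd n; rewrite le_min => /andP[].
  by exists n => //; exists j; rewrite // /G' jK.
apply: (@le_trans _ _ (\sum_(n <oo) (e / (2 ^ n.+1)%:R)%:E)%E); last first.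
  exact: (epsilon_trick0 xpredT (ltW e0)).
apply: lee_nneseries => [n _ _|n _].
  by apply: nneseries_ge0 => *; exact: diam_pow_ge0.
apply: (@le_trans _ _ ((K n)%:R * d n `^ s)%:E).
  apply: nneseries_bounded_support => [|j|j]; [exact: powR_ge0|exact: diam_pow_ge0|].
  rewrite /G'; case: ifP => jK; last by rewrite /diam_pow eqxx.
  exact: diam_pow_le (ltW s0) (hG _ _ jK).
rewrite lee_fin; apply: (le_trans (hK n)).
by rewrite ler_wpM2r ?invr_ge0 // ge_min lexx.
Qed.

(** Subdividing [0, 1] into [M] equal parts costs about [M `^ (1 - s)]. *)
Lemma hausdorff_measure_unit_eq0 s A : 1 < s -> A `<=` `[0, 1] ->
  hausdorff_measure s A = 0%E.
Proof.
move=> s1 AI; apply: hausdorff_measure_eq0 => [|e e0].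
  exact: lt_trans s1.
pose M := (Num.truncn (Num.max e^-1 ((4 / e) `^ (s - 1)^-1))).+1.
have := truncnS_gt (Num.max e^-1 ((4 / e) `^ (s - 1)^-1)).
rewrite -/M gt_max => /andP[M1 M2].
have M0 : 0 < M%:R :> R by [].
exists (fun n => if n is 0 then M.+1 else 0), (fun n => if n is 0 then M%:R^-1 else 0),
  (fun _ j => [set` `[j%:R / M%:R, j.+1%:R / M%:R]]).
split=> [[|n]|[|n] j|[|n]|x /AI /=].
- by rewrite invr_ge0 ler0n /= -(invrK e) lef_pV2 ?posrE ?invr_gt0 // ltW.
- by rewrite lexx ltW.
- move=> _; apply: diam_le; first by rewrite invr_ge0.
  move=> x y /=; rewrite !in_itv /= => /andP[x0 x1] /andP[y0 y1].
  have E : j.+1%:R / M%:R = j%:R / M%:R + M%:R^-1 :> R by rewrite -natr1 mulrDl mul1r.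
  by rewrite E in x1 y1; rewrite ler_norml; apply/andP; split; lra.
- by [].
- have MsE : M%:R^-1 `^ s = M%:R^-1 * (M%:R `^ (s - 1))^-1.
    rewrite -powR_inv1 ?ler0n // -powRrM mulN1r -powRN -powRD; last first.
      by rewrite (gt_eqF M0) implybT.
    by congr powR; lra.
  rewrite MsE expn1.
  have M2' : 4 / e < M%:R `^ (s - 1).
    have -> : 4 / e = ((4 / e) `^ (s - 1)^-1) `^ (s - 1).
      rewrite -powRrM mulVf ?powRr1 ?divr_ge0 ?ltW // gt_eqF; lra.
    by apply: gt0_ltr_powR => //; rewrite ?nnegrE ?powR_ge0 //; lra.
  rewrite mulrA; apply: (@le_trans _ _ (2 * (e / 4))); last lra.
  apply: ler_pM; rewrite ?invr_ge0 ?powR_ge0 ?divr_ge0 //.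
    rewrite ler_pdivrMr // -natr1.
    have : 1 <= M%:R :> R by rewrite ler1n.
    lra.
  by rewrite -(invf_div 4) lef_pV2 ?posrE ?ltW ?divr_gt0 // powR_gt0.
- by rewrite mul0r divr_ge0 // ltW.
rewrite in_itv /= => /andP[x0 x1].
have xM0 : 0 <= x * M%:R by rewrite mulr_ge0.
have /andP[t1 t2] := truncn_itv xM0.
exists 0%N => //; exists (Num.truncn (x * M%:R)) => /=.
  rewrite ltnS -(ler_nat R); apply: (le_trans t1); rewrite ler_piMl //.
by rewrite in_itv /= ler_pdivrMr // t1 ler_pdivlMr // ltW.
Qed.

(** A set that maps onto [0, 1) by a Hoelder map of exponent [s] has positive
    measure: a cover of [A] induces a cover of [0, 1) by sets [E i] contained in
    intervals of length at most [2 * C] times the [s]-th power of the diameter,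
    and the lengths of these intervals add up to at least 1. The Hoelder map is
    given through its right inverse [g]. *)
Lemma holder_parametrization_hausdorff_measure A (g : R -> R) s (C : R) :
  0 <= s -> 0 < C -> (forall t : R, 0 <= t < 1 -> A (g t)) ->
  (forall t u : R, 0 <= t < 1 -> 0 <= u < 1 -> `|t - u| <= C * `|g t - g u| `^ s) ->
  hausdorff_measure s A != 0%E.
Proof.
move=> s0 C0 gA hg.
suff : ((2 * C)^-1%:E <= hausdorff_measure s A)%E.
  move=> h; rewrite gt_eqF //; apply: lt_le_trans h; rewrite lte_fin invr_gt0; lra.
apply: le_ereal_sup_tmp; exists (hausdorff_content s 1 A); first by exists 1 => /=.
apply: le_ereal_inf_tmp => z [F [Fd AF] <-].
pose E i := [set t : R | 0 <= t < 1 /\ F i (g t)].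
pose r i := fine (diam_pow s (F i)).
have dpE i : diam_pow s (F i) = (r i)%:E.
  rewrite fineK // ge0_fin_numE ?diam_pow_ge0 //.
  exact: le_lt_trans (diam_pow_le _ _ _ s0 (Fd i)) (ltry _).
have hE i t u : E i t -> E i u -> `|t - u| <= C * r i.
  move=> [tI Ft] [uI Fu]; apply: (le_trans (hg _ _ tI uI)); rewrite ler_pM2l //.
  have Fi0 : F i != set0 by apply/set0P; exists (g t).
  have Ed := diam_fineK _ _ (Fd i).
  have := le_diam _ _ _ Ft Fu.
  have := dpE i; rewrite /diam_pow (negPf Fi0) -Ed poweR_EFin => -[<-].
  rewrite lee_fin => h; apply: ge0_ler_powR => //; rewrite ?nnegrE //.
  exact: le_trans h.
have center i : exists c, forall t, E i t -> `|t - c| <= C * r i.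
  have [[u Eu]|nE] := pselect (exists u, E i u).
    by exists u => t Et; exact: hE.
  by exists 0 => t Et; exfalso; apply: nE; exists t.
have [c hc] := choice center.
have r0 i : 0 <= r i by rewrite -lee_fin -dpE diam_pow_ge0.
have h1 : (1 <= \sum_(i <oo) (2 * C * r i)%:E)%E.
  have -> : 1%E = lebesgue_measure ([set` `[0 : R, 1[]).
    by rewrite lebesgue_measure_itv /= lte_fin ltr01 oppr0 adde0.
  pose B i := [set` `[c i - C * r i, c i + C * r i]].
  apply: (@le_trans _ _ (\sum_(i <oo) lebesgue_measure (B i))%E).
    apply: measure_sigma_subadditive => //.
      by move=> i; exact: measurable_itv.
    move=> t /=; rewrite in_itv /= => tI.
    have [i _ Fi] := AF _ (gA _ tI).
    exists i => //; rewrite /B /mkset in_itv /=.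
    have := hc i t (conj tI Fi); rewrite ler_norml => /andP[? ?].
    by apply/andP; split; lra.
  apply: lee_nneseries => [i _ _ //|i _].
  rewrite lebesgue_measure_itv /=; case: ifP => _; last first.
    by rewrite lee_fin !mulr_ge0 // ltW.
  by rewrite -EFinB lee_fin; lra.
have -> : (\sum_(i <oo) diam_pow s (F i) = \sum_(i <oo) (r i)%:E)%E.
  by apply: eq_eseriesr => i _.
have E2 : (\sum_(i <oo) (2 * C * r i)%:E = (2 * C)%:E * \sum_(i <oo) (r i)%:E)%E.
  rewrite -nneseriesZl => [|i _]; last by rewrite lee_fin.
  by apply: eq_eseriesr => i _.
by rewrite -(mulr1 (_^-1)) EFinM lee_pdivrMl -?E2 // mulr_gt0.
Qed.
End Hausdorff.

(** * Full intervals and their number *)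

Section FullIntervals.
Variables (R : realType) (beta : R).
Hypothesis beta_gt1 : 1 < beta.
Implicit Types (x y z a b c : R) (n i j k : nat).

Let beta_gt0 : 0 < beta. Proof. exact: lt_trans beta_gt1. Qed.

Let betaX_gt0 n : 0 < beta ^+ n. Proof. exact: exprn_gt0. Qed.

(** [a] is the left endpoint of a full cylinder of order [n]: one on which the
    [n]-th iterate is the increasing affine bijection onto [0, 1). *)
Definition full n a := forall y, 0 <= y < 1 ->
  0 <= a + y / beta ^+ n < 1 /\ iter n (beta_map beta) (a + y / beta ^+ n) = y.

Lemma full0 : full 0 0.
Proof. by move=> y yI; rewrite expr0 divr1 add0r. Qed.

Lemma full_cat n k a b : full n a -> full k b -> full (n + k) (a + b / beta ^+ n).
Proof.
move=> fa fb y yI; have [bI Tb] := fb y yI; have [aI Ta] := fa _ bI.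
have -> : a + b / beta ^+ n + y / beta ^+ (n + k) =
          a + (b + y / beta ^+ k) / beta ^+ n.
  by rewrite exprD invfM; ring.
by split=> //; rewrite addnC iterD Ta.
Qed.

Lemma full1_0 : full 1 0.
Proof.
move=> y /andP[y0 y1]; rewrite expr1 add0r; split.
  by rewrite divr_ge0 ?(ltW beta_gt0) //= ltr_pdivrMr // mul1r (lt_trans y1).
have E : beta * (y / beta) = y by rewrite mulrCA divff ?mulr1 ?gt_eqF.
by rewrite /= (@beta_mapE _ _ _ 0) E ?subr0 ?y0.
Qed.

Lemma full_zero n : full n 0.
Proof.
elim: n => [|n IH]; first exact: full0.
by have := full_cat _ _ _ _ full1_0 IH; rewrite mul0r addr0 add1n.
Qed.

Lemma full_widen n k a : full n a -> full (n + k) a.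
Proof. by move=> fa; have := full_cat _ _ _ _ fa (full_zero k); rewrite mul0r addr0. Qed.

Lemma full_itv n a : full n a -> 0 <= a <= 1 - beta ^- n.
Proof.
move=> fa; have /fa[/andP[a0 a1] _] : 0 <= (0 : R) < 1 by rewrite lexx ltr01.
rewrite mul0r addr0 in a0 a1; rewrite a0 /= leNgt; apply/negP => h.
have /fa[/andP[_ +] _] : 0 <= (1 - a) * beta ^+ n < 1.
  rewrite mulr_ge0 ?ltW //=; last by rewrite subr_gt0.
  by rewrite -ltr_pdivlMr // mul1r; lra.
by rewrite mulfK ?gt_eqF // addrC subrK ltxx.
Qed.

(** On a full interval the [n]-th iterate is the relative position in the
    interval. It cannot be so in two overlapping intervals with different left
    endpoints. *)
Lemma full_separated n a b : full n a -> full n b -> a != b ->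
  beta ^- n <= `|a - b|.
Proof.
wlog ab : a b / a < b.
  move=> h fa fb ne; case: (ltgtP a b) (ne) => [||->]; rewrite ?eqxx //.
    by move=> ab _; exact: h.
  by move=> ba _; rewrite distrC; apply: h => //; rewrite eq_sym.
move=> fa fb _; rewrite leNgt; apply/negP.
rewrite distrC gtr0_norm ?subr_gt0 // => h.
have /fa[_ +] : 0 <= (b - a) * beta ^+ n < 1.
  rewrite mulr_ge0 ?ltW ?subr_gt0 //=.
  by rewrite -ltr_pdivlMr // mul1r.
rewrite mulfK ?gt_eqF // addrC subrK.
have /fb[_ +] : 0 <= (0 : R) < 1 by rewrite lexx ltr01.
rewrite mul0r addr0 => -> /eqP; rewrite eq_sym mulf_eq0 subr_eq0.
by rewrite (gt_eqF ab) (gt_eqF (betaX_gt0 n)).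
Qed.

(** Peeling off full intervals of orders 1 to [j] leaves an interval [[c, 1)] on
    which the [j]-th iterate is affine, as its digits are the first [j] digits of
    the quasi-greedy expansion of 1. The image of this interval is [[0, r)] with
    [r <= 1]; dividing it into steps of length [1 / beta], every step but the
    last gives a full interval of order [j + 1] and the last step is the next
    residual interval. *)
Lemma residual_interval j : exists c,
  [/\ 0 <= c <= 1, 1 - c <= beta ^- j,
      forall y, c <= y < 1 -> iter j (beta_map beta) y = beta ^+ j * (y - c) &
      forall y, 0 <= y < c -> exists i a,
        [/\ (0 < i <= j)%N, full i a & a <= y < a + beta ^- i]].
Proof.
elim: j => [|j [c [/andP[c0 c1] hc Tc fc]]].
  exists 0; split; rewrite ?lexx ?ler01 ?expr0 ?invr1 ?subr0 //.
    by move=> y yI; rewrite mul1r subr0.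
  by move=> y /andP[/le_lt_trans h /h]; rewrite ltxx.
have fc' y : 0 <= y < c -> exists i a,
    [/\ (0 < i <= j.+1)%N, full i a & a <= y < a + beta ^- i].
  move=> /fc[i [a [/andP[i0 ij] fa aI]]]; exists i, a; split=> //.
  by rewrite i0 leqW.
(* If c = 1 nothing is left to divide and the same c works for j.+1. *)
move: c1; rewrite le_eqVlt => /predU1P[c1|c1].
  exists c; split=> //.
  - by rewrite c0 c1 /=.
  - by rewrite c1 subrr invr_ge0 ltW.
  - by move=> y; rewrite c1 => /andP[/le_lt_trans h /h]; rewrite ltxx.
pose r := beta ^+ j.+1 * (1 - c).
have r0 : 0 < r by rewrite mulr_gt0 // subr_gt0.
(* d is the digit of the last step; it is the ceiling of r minus one, not the
   floor, so that a last step of full length also counts as residual. *)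
have [d /andP[dr rd]] : exists d : nat, d%:R < r <= d.+1%:R.
  exists `|Num.ceil r - 1|%N.
  have c0' : 0 <= Num.ceil r - 1 by rewrite subr_ge0 -gtz0_ge1 -ceil_gt0 in r0 *.
  rewrite -natr1 natr_absz ger0_norm // intrB.
  have /andP[h1 h2] := ceil_itv r.
  by move: h1; rewrite intrB => h1; rewrite h1 /=; lra.
have bj0 := betaX_gt0 j.+1; have bjn0 : beta ^+ j.+1 != 0 by rewrite gt_eqF.
pose q := beta ^- j.+1; have q0 : 0 < q by rewrite invr_gt0.
have rq : r * q = 1 - c by rewrite /r /q mulrAC divff // mul1r.
exists (c + d%:R * q).
have dq : d%:R * q < 1 - c by rewrite -rq ltr_pM2r.
have dq' : 1 - c <= d%:R * q + q.
  by rewrite -rq -[X in _ + X]mul1r -mulrDl ler_pM2r // natr1.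
have d0 : 0 <= d%:R * q by rewrite mulr_ge0 // ltW.
split; [by apply/andP; split; lra|by rewrite -/q; lra| |].
  move=> y /andP[y1 y2].
  rewrite iterS Tc; last by apply/andP; split; lra.
  have E : beta * (beta ^+ j * (y - c)) = beta ^+ j.+1 * (y - c) by rewrite exprS mulrA.
  have E' : beta ^+ j.+1 * (y - c - d%:R * q) = beta ^+ j.+1 * (y - c) - d%:R.
    by rewrite mulrBr [X in _ - X]mulrCA divff // mulr1.
  rewrite (@beta_mapE _ _ _ d) E.
    by rewrite -E'; congr (_ * _); ring.
  apply/andP; split.
    rewrite -subr_ge0 -E' mulr_ge0 //; [exact: ltW|lra].
  apply: lt_le_trans rd; rewrite /r ltr_pM2l //; lra.
move=> y /andP[y0 y1]; have [yc|cy] := ltP y c.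
  by apply: fc'; rewrite y0.
have z0 : 0 <= (y - c) * beta ^+ j.+1 by rewrite mulr_ge0 ?subr_ge0 // ltW.
have /andP[e1 e2] := truncn_itv z0.
set e := Num.truncn _ in e1 e2.
have e1' : e%:R * q <= y - c by rewrite ler_pdivrMr.
have e2' : y - c < e.+1%:R * q by rewrite ltr_pdivlMr.
have ed : (e < d)%N.
  rewrite -(ltr_nat R) -(ltr_pM2r q0); lra.
have ed' : e.+1%:R * q <= d%:R * q by rewrite ler_pM2r // ler_nat.
have eS : e.+1%:R * q = e%:R * q + q by rewrite -natr1 mulrDl mul1r.
have eq0 : 0 <= e%:R * q by rewrite mulr_ge0 // ltW.
exists j.+1, (c + e%:R * q); split; rewrite -/q ?leqnn //; last by apply/andP; split; lra.
move=> z /andP[z_ge0 z_lt1]; rewrite -/q.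
have zq0 : 0 <= z * q by rewrite mulr_ge0 // ltW.
have zq1 : z * q < q by rewrite -[ltRHS]mul1r ltr_pM2r.
split; first by apply/andP; split; lra.
have E : beta * (beta ^+ j * (c + e%:R * q + z * q - c)) = e%:R + z.
  rewrite mulrA -exprS.
  rewrite (_ : _ * _ = (e%:R + z) * (beta ^+ j.+1 * q)); last by ring.
  by rewrite divff // mulr1.
rewrite iterS Tc; last by apply/andP; split; lra.
by rewrite (@beta_mapE _ _ _ e) E -?natr1; [ring|lra].
Qed.

(** Choosing for [x] a full interval of maximal order [i <= n] among those
    containing it places [x] in the residual part of that interval, a piece of
    length at most [beta ^- n]. *)
Lemma full_decomposition : exists c : nat -> R,
  (forall j, 1 - c j <= beta ^- j) /\
  forall n x, 0 <= x < 1 -> exists i a,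
    [/\ (i <= n)%N, full i a & a + c (n - i)%N / beta ^+ i <= x < a + beta ^- i].
Proof.
have [c hc] := choice residual_interval.
exists c; split=> [j|n x xI]; first by have [] := hc j.
suff main k i a : (n - i <= k)%N -> (i <= n)%N -> full i a -> a <= x < a + beta ^- i ->
    exists i a, [/\ (i <= n)%N, full i a & a + c (n - i)%N / beta ^+ i <= x < a + beta ^- i].
  apply: (main n 0 0) => //; first by rewrite subn0.
    exact: full0.
  by rewrite expr0 invr1 add0r.
elim: k i a => [|k IH] i a ik iN fa /andP[ax xa].
all: have [/andP[c0 c1] _ _ fc] := hc (n - i)%N.
all: have bi0 := betaX_gt0 i.
all: have y0 : 0 <= (x - a) * beta ^+ i by rewrite mulr_ge0 ?subr_ge0 // ltW.
all: have y1 : (x - a) * beta ^+ i < 1 by rewrite -ltr_pdivlMr // mul1r; lra.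
all: have [cy|yc] := leP (c (n - i)%N) ((x - a) * beta ^+ i);
  first by exists i, a; split=> //; rewrite xa andbT addrC -lerBrDr ler_pdivrMr.
all: have /fc[i' [a' [/andP[i0 i'n] fa' /andP[h1 h2]]]] :
  0 <= (x - a) * beta ^+ i < c (n - i)%N by rewrite y0.
  by have := leq_trans i0 (leq_trans i'n ik).
apply: (IH (i + i')%N (a + a' / beta ^+ i)); last 1 first.
- rewrite -ler_pdivrMr // in h1; rewrite -ltr_pdivlMr // mulrDl in h2.
  by rewrite exprD invfM [_^-1 * _]mulrC; apply/andP; split; lra.
- by clear -ik i0 i'n iN; lia.
- by clear -i'n iN; lia.
- exact: full_cat.
Qed.

(** A point of the grid of step [beta ^- n] is determined by its full interval in
    [full_decomposition], because the pieces are half-open of length at most one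
    step. This injects about [beta ^+ n] grid points into the pairs of an order
    [i <= n] and a left endpoint. A left endpoint of order [i] is also one of
    order [n], so the endpoints alone number at least [beta ^+ n / n], up to a
    constant factor. *)
Lemma many_full n : exists s : seq R,
  [/\ uniq s, forall a, a \in s -> full n a &
      beta ^+ n <= 2 * ((size s)%:R * n.+1%:R)].
Proof.
have [c [hc dec]] := full_decomposition.
have bn0 := betaX_gt0 n.
pose K := Num.truncn (beta ^+ n).
have /andP[K1 K2] : K%:R <= beta ^+ n < K.+1%:R by apply: truncn_itv; exact: ltW.
have grid (l : 'I_K) : exists p : 'I_n.+1 * R,
    full p.1 p.2 /\ p.2 + c (n - p.1)%N / beta ^+ p.1 <= l%:R / beta ^+ n < p.2 + beta ^- p.1.
  have lI : 0 <= l%:R / beta ^+ n < 1.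
    rewrite divr_ge0 ?(ltW bn0) //= ltr_pdivrMr // mul1r.
    by apply: lt_le_trans K1; rewrite ltr_nat.
  have [i [a [iN fa ha]]] := dec n _ lI.
  by exists (inord i, a); rewrite /= inordK.
have [f hf] := choice grid.
pose s := undup [seq (f l).2 | l : 'I_K].
exists s; split; first exact: undup_uniq.
  move=> a; rewrite mem_undup => /mapP[l _ ->].
  have [fl _] := hf l; have := full_widen _ (n - (f l).1)%N _ fl.
  by rewrite subnKC // -ltnS.
have sf l : (f l).2 \in s by rewrite mem_undup; apply/mapP; exists l; rewrite ?mem_enum.
pose h (l : 'I_K) : 'I_(size s) * 'I_n.+1 :=
  (Ordinal (etrans (index_mem _ _) (sf l)), (f l).1).
have h_inj : injective h.
  move=> l l' [Es Ei].
  have Ea : (f l).2 = (f l').2.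
    by rewrite -(nth_index 0 (sf l)) Es nth_index.
  have [_ /andP[h1 h2]] := hf l; have [_ /andP[h3 h4]] := hf l'.
  have bi0 := betaX_gt0 (f l).1.
  rewrite -Ei -Ea in h3 h4.
  have gap : (1 - c (n - (f l).1)%N) / beta ^+ (f l).1 <= beta ^- n.
    have -> : beta ^- n = beta ^- (n - (f l).1)%N / beta ^+ (f l).1.
      by rewrite -invfM -exprD addnC subnKC // -ltnS.
    by rewrite ler_pM2r ?invr_gt0.
  rewrite mulrBl mul1r in gap.
  have dist : `|l%:R / beta ^+ n - l'%:R / beta ^+ n| < beta ^- n.
    by rewrite ltr_norml; apply/andP; split; lra.
  rewrite -mulrBl normrM [X in _ * X]gtr0_norm ?invr_gt0 // in dist.
  rewrite -[ltRHS]mul1r ltr_pM2r ?invr_gt0 // ltr_norml in dist.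
  move/andP: dist => [d1 d2].
  have d1' : (l' < l.+1)%N by rewrite -(ltr_nat R) -natr1; lra.
  have d2' : (l < l'.+1)%N by rewrite -(ltr_nat R) -natr1; lra.
  by apply/val_inj/eqP; rewrite eqn_leq -ltnS d2'.
have := leq_card h h_inj; rewrite card_prod !card_ord => Ks.
have K_gt0 : (0 < K)%N by rewrite truncn_gt0 exprn_ege1 // ltW.
apply: (le_trans (ltW K2)).
rewrite -!natrM ler_nat; apply: (@leq_trans (2 * K)); last by rewrite leq_mul2l Ks orbT.
by rewrite mul2n -addnn -[ltnLHS]addn0 ltn_add2l.
Qed.
End FullIntervals.

(** * Positions carrying a forced zero *)

Section SparseBlocks.
Local Open Scope nat_scope.
Implicit Types (Q j k : nat).

(** For [j > 0] and [k] such that [2 ^ k <= j < 2 ^ k.+1], the forced positions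
    are the first [2 ^ k %/ Q] ones of this dyadic block. Long runs at each
    power of 2 are obtained at the price of a density at most [2 / Q]. *)
Definition forced Q j := Q * (j - 2 ^ trunc_log 2 j).+1 <= 2 ^ trunc_log 2 j.

Lemma forced_dyadic Q k i : i < 2 ^ k -> forced Q (2 ^ k + i) = (Q * i.+1 <= 2 ^ k).
Proof.
move=> ik; have E : trunc_log 2 (2 ^ k + i) = k.
  by apply: trunc_log_eq => //; rewrite expnS; lia.
by rewrite /forced E addKn.
Qed.

Lemma forced_block Q k i : 0 < Q -> i < 2 ^ k %/ Q -> forced Q (2 ^ k + i).
Proof.
move=> Q0 ik; rewrite forced_dyadic; last exact: leq_trans ik (leq_div _ _).
by rewrite mulnC -leq_divRL.
Qed.

Lemma sum_multiples_le Q P M : Q * (\sum_(0 <= i < M) (Q * i.+1 <= P)) <= P.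
Proof.
elim: M => [|M IH]; first by rewrite big_geq // muln0.
have [QM|QM] := leqP (Q * M.+1) P.
  apply: leq_trans QM; rewrite leq_mul2l; apply/orP; right.
  apply: (@leq_trans (\sum_(0 <= i < M.+1) 1)); first by apply: leq_sum => i _; exact: leq_b1.
  by rewrite sum_nat_const_nat subn0 muln1.
by rewrite big_nat_recr //= (ltn_geF QM) addn0.
Qed.

(** A dyadic block has density at most [1 / Q] of forced positions; the factor 2
    accounts for an incomplete last block. *)
Lemma sum_forced_le Q K : Q * (\sum_(0 <= j < K) forced Q j) <= 2 * K.
Proof.
have pow2 k : Q * (\sum_(0 <= j < 2 ^ k) forced Q j) <= 2 ^ k.
  elim: k => [|k IH].
    by rewrite expn0 big_nat1 /forced trunc_log0 expn0 muln1; case: Q => [|[|Q]]; rewrite ?muln0.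
  rewrite expnS mul2n -addnn (big_cat_nat (leq0n _) (leq_addr _ _)) /= mulnDr.
  apply: leq_add => //; rewrite -{1}[2 ^ k]add0n big_addn addnK.
  apply: leq_trans (sum_multiples_le Q (2 ^ k) (2 ^ k)).
  rewrite leq_mul2l; apply/orP; right; rewrite !big_nat.
  by apply: leq_sum => i /andP[_ ik]; rewrite addnC forced_dyadic.
case: K => [|K]; first by rewrite big_geq ?muln0.
have /andP[k1 k2] := trunc_log_bounds (isT : 1 < 2) (isT : 0 < K.+1).
apply: (@leq_trans (2 ^ (trunc_log 2 K.+1).+1)); last by rewrite expnS leq_mul2l k1.
apply: leq_trans (pow2 _); rewrite leq_mul2l; apply/orP; right.
by rewrite (big_cat_nat (leq0n _) (ltnW k2)) leq_addr.
Qed.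
End SparseBlocks.

(** * A Cantor set coded by the points of [0, 1) *)

Section Coding.
Variable R : realType.
Implicit Types (t u rho gap sigma : R) (j k n K : nat).

(** The tails [y k] of the expansion whose [j]-th term is [rho ^+ j * a j], all at
    once and without summation signs: only their recurrence is used. *)
Lemma radix_tails rho (a : nat -> R) : 0 <= rho < 1 ->
  (forall k, 0 <= a k <= 1 - rho) ->
  exists y : nat -> R, forall k, 0 <= y k <= 1 /\ y k = a k + rho * y k.+1.
Proof.
move=> /andP[rho0 rho1] ha.
pose fix part (n k : nat) {struct n} : R := if n is m.+1 then a k + rho * part m k.+1 else 0.
have part01 n k : 0 <= part n k <= 1.
  elim: n k => [|n IH] k /=; first by rewrite lexx ler01.
  have /andP[a0 a1] := ha k; have /andP[p0 p1] := IH k.+1.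
  rewrite addr_ge0 ?mulr_ge0 //=.
  have : rho * part n k.+1 <= rho by rewrite ler_piMr.
  by lra.
have partS n k : part n k <= part n.+1 k.
  elim: n k => [|n IH] k; first by have /andP[] := part01 1 k.
  by rewrite /= lerD2l ler_wpM2l // IH.
have cvg_part k : cvgn (part^~ k).
  apply: nondecreasing_is_cvgn; first exact/nondecreasing_seqP.
  by exists 1 => _ [n _ <-]; have /andP[] := part01 n k.
exists (fun k => limn (part^~ k)) => k; split.
  apply/andP; split.
    by apply: limr_ge => //; apply: nearW => n; have /andP[] := part01 n k.
  by apply: limr_le => //; apply: nearW => n; have /andP[] := part01 n k.
apply: cvg_lim => //; rewrite -cvg_shiftS /=.
by apply: cvgD; [exact: cvg_cst|apply: cvgMr; exact: cvg_part].
Qed.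

Variables (s : seq R) (Z : pred nat).
Hypothesis s_uniq : uniq s.
Hypothesis s_gt0 : (0 < size s)%N.
Let N : R := (size s)%:R.

Let N_gt0 : 0 < N. Proof. by rewrite ltr0n. Qed.

(** The expansion of [t] in base [N] is consumed one digit at a time, at the free
    positions only; [state t k] is the part still to be read at position [k]. *)
Fixpoint state t k : R :=
  if k is j.+1 then if Z j then state t j else beta_map N (state t j) else t.

Definition letter t k : R :=
  if Z k then 0 else nth 0 s (Num.truncn (N * state t k)).

Definition free_count K := (\sum_(0 <= j < K) ~~ Z j)%N.

Lemma state_itv t k : 0 <= t < 1 -> 0 <= state t k < 1.
Proof.
move=> tI; elim: k => //= k IH; case: ifP => // _; exact: beta_map_ge0_lt1.
Qed.

Let digit_itv t k : 0 <= t < 1 ->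
  (Num.truncn (N * state t k))%:R <= N * state t k < (Num.truncn (N * state t k)).+1%:R.
Proof.
move=> tI; apply: truncn_itv; have /andP[s0 _] := state_itv t k tI.
by rewrite mulr_ge0 // ltW.
Qed.

Let digit_lt t k : 0 <= t < 1 -> (Num.truncn (N * state t k) < size s)%N.
Proof.
move=> tI; have /andP[h _] := digit_itv t k tI.
have /andP[_ s1] := state_itv t k tI.
rewrite -(ltr_nat R); apply: (le_lt_trans h).
by rewrite -[ltRHS]mulr1 ltr_pM2l.
Qed.

Lemma letter_mem t k : 0 <= t < 1 -> letter t k \in 0 :: s.
Proof.
move=> tI; rewrite /letter in_cons; case: ifP => _; first by rewrite eqxx.
by rewrite mem_nth ?orbT // digit_lt.
Qed.

(** Equal letters at a free position mean equal base [N] digits, hence the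
    difference of the states is multiplied by [N] there and is left unchanged at
    the forced positions. *)
Lemma eq_letters_sub t u K : 0 <= t < 1 -> 0 <= u < 1 ->
  (forall k, (k < K)%N -> letter t k = letter u k) ->
  t - u = (state t K - state u K) / N ^+ free_count K.
Proof.
move=> tI uI; elim: K => [|K IH] eq_tu.
  by rewrite /free_count big_geq // expr0 divr1.
rewrite {}IH; last by move=> k kK; apply: eq_tu; exact: ltnW.
have := eq_tu _ (ltnSn K).
rewrite /letter /free_count big_nat_recr //=; case: ifP => _ /=; first by rewrite addn0.
move=> /eqP; rewrite nth_uniq ?digit_lt // => /eqP eq_d.
rewrite (beta_mapE _ _ _ _ (digit_itv t K tI)) (beta_mapE _ _ _ _ (digit_itv u K uI)).
rewrite eq_d; set d := _%:R; set a := state t K; set b := state u K.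
have -> : N * a - d - (N * b - d) = N * (a - b) by ring.
by rewrite exprD expr1 [N * (a - b)]mulrC -mulf_div divff ?mulr1 ?gt_eqF.
Qed.

(** At the first position [K] where the letters of [t] and [u] differ, the coded
    points are at distance at least [gap * rho ^+ K], since distinct letters are
    further apart than the tails can compensate, whereas [t] and [u] themselves
    share [free_count K] digits in base [N]. *)
Lemma coding_holder rho gap sigma (x : R -> nat -> R) t u :
  0 < rho < 1 -> 0 < gap -> 0 < sigma ->
  {in 0 :: s &, forall a b, a != b -> gap + rho <= `|a - b|} ->
  (forall t k, 0 <= t < 1 -> 0 <= x t k <= 1) ->
  (forall t k, 0 <= t < 1 -> x t k = letter t k + rho * x t k.+1) ->
  (forall K, 1 <= (rho `^ sigma) ^+ K * N ^+ free_count K) ->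
  0 <= t < 1 -> 0 <= u < 1 ->
  `|t - u| <= (gap `^ sigma)^-1 * `|x t 0%N - x u 0%N| `^ sigma.
Proof.
move=> /andP[rho0 rho1] gap0 sigma0 sep x01 xE hN tI uI.
have close K : (forall k, (k < K)%N -> letter t k = letter u k) ->
    `|t - u| <= (rho `^ sigma) ^+ K.
  move=> /(eq_letters_sub _ _ _ tI uI) ->.
  have /andP[? ?] := state_itv t K tI; have /andP[? ?] := state_itv u K uI.
  rewrite normrM [X in _ * X]gtr0_norm ?invr_gt0 ?exprn_gt0 // ler_pdivrMr ?exprn_gt0 //.
  by apply: le_trans (hN K); rewrite ler_norml; apply/andP; split; lra.
have [[k0 hk0]|same] := pselect (exists k, letter t k != letter u k); last first.
  have -> : `|t - u| = 0; last first.
    by rewrite mulr_ge0 ?invr_ge0 ?powR_ge0.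
  apply/eqP; rewrite eq_le normr_ge0 andbT leNgt; apply/negP => tu0.
  have : rho `^ sigma < 1 `^ sigma.
    by apply: gt0_ltr_powR; rewrite ?nnegrE ?ler01 ?ltW.
  rewrite powR1 -invf_gt1 ?powR_gt0 // => rs1.
  have [K] := exprn_unbounded _ _ `|t - u|^-1 rs1.
  rewrite exprVn ltf_pV2 ?posrE ?exprn_gt0 ?powR_gt0 // ltNge => /negP; apply.
  by apply: close => k _; apply/eqP/negPn/negP => h; apply: same; exists k.
have ex0 : exists k, letter t k != letter u k by exists k0.
case: (ex_minnP ex0) => K neK minK {k0 hk0 ex0}.
have eq_tu k : (k < K)%N -> letter t k = letter u k.
  by move=> kK; apply/eqP; apply: contraLR kK; rewrite -leqNgt; exact: minK.
have xdiff k : (k <= K)%N -> x t 0%N - x u 0%N = rho ^+ k * (x t k - x u k).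
  elim: k => [|k IH] kK; first by rewrite expr0 mul1r.
  rewrite IH ?(ltnW kK) // xE // [x u k]xE // (eq_tu _ kK) exprS; ring.
have dK : gap * rho ^+ K <= `|x t 0%N - x u 0%N|.
  rewrite (xdiff K) // normrM gtr0_norm ?exprn_gt0 // mulrC ler_pM2l ?exprn_gt0 //.
  rewrite xE // [x u K]xE //.
  have /andP[p0 p1] := x01 t K.+1 tI; have /andP[q0 q1] := x01 u K.+1 uI.
  have := sep _ _ (letter_mem t K tI) (letter_mem u K uI) neK.
  set a := letter t K; set b := letter u K => h.
  have h1 : `|rho * x t K.+1 - rho * x u K.+1| <= rho.
    rewrite -mulrBr normrM gtr0_norm // ler_piMr ?(ltW rho0) // ler_norml.
    by apply/andP; split; lra.
  have h2 := lerB_normD (a - b) (rho * x t K.+1 - rho * x u K.+1).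
  have -> : a + rho * x t K.+1 - (b + rho * x u K.+1) =
    a - b + (rho * x t K.+1 - rho * x u K.+1) by ring.
  by lra.
apply: (le_trans (close K eq_tu)).
rewrite ler_pdivlMl ?powR_gt0 //.
rewrite exprn_powR ?(ltW rho0) //.
have gap_ge0 := ltW gap0; have rhoK_ge0 : 0 <= rho ^+ K by rewrite exprn_ge0 // ltW.
rewrite -powRM //; apply: ge0_ler_powR => //; first exact: ltW.
by rewrite nnegrE mulr_ge0.
Qed.
End Coding.

(** * Eventual bounds from the exponents *)

Section Exponents.
Variables (R : realType) (beta : R) (psi : nat -> R).
Hypothesis beta_gt1 : 1 < beta.
Hypothesis psi_gt0 : forall n, 0 < psi n.

Let ln_beta_gt0 : 0 < ln beta. Proof. exact: ln_gt0. Qed.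

Lemma limn_esup_lt_near (u : nat -> \bar R) (l : \bar R) :
  (limn_esup u < l)%E -> \forall n \near \oo, (u n < l)%E.
Proof.
move=> /ereal_inf_lt[_ [V Voo <-] supV].
apply: filterS Voo => n Vn; apply: le_lt_trans supV.
by apply: ereal_sup_ubound; exists n.
Qed.

Lemma psi_powR n : psi n = beta `^ (ln (psi n) / ln beta).
Proof.
rewrite /powR gt_eqF ?(lt_trans ltr01 beta_gt1) // mulfVK ?gt_eqF //.
by rewrite lnK // posrE.
Qed.

Lemma upper_exponent0_gt (e : R) : upper_exponent beta psi = 0%E -> 0 < e ->
  \forall n \near \oo, beta `^ (- (e * n%:R)) < psi n.
Proof.
move=> u0 e0; near=> n.
have n0 : 0 < n%:R :> R by rewrite ltr0n; near: n; exact: nbhs_infty_gt.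
have : (decay_rate beta psi n < e%:E)%E.
  near: n; apply: limn_esup_lt_near.
  by rewrite -/(upper_exponent beta psi) u0 lte_fin.
rewrite lte_fin ltr_pdivrMr // /logb => h.
by rewrite [ltRHS]psi_powR gt1_ltr_powRr // ltrNl.
Unshelve. all: by end_near. Qed.

Lemma lower_exponent_pinfty_lt (L : R) : lower_exponent beta psi = +oo%E ->
  \forall n \near \oo, psi n < beta `^ (- (L * n%:R)).
Proof.
move=> loo; near=> n.
have n0 : 0 < n%:R :> R by rewrite ltr0n; near: n; exact: nbhs_infty_gt.
have : (- decay_rate beta psi n < (- L)%:E)%E.
  near: n; apply: limn_esup_lt_near.
  move: loo; rewrite /lower_exponent /limn_einf => /(congr1 (@oppe R)).
  by rewrite oppeK => ->; exact: ltNyr.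
rewrite -EFinN lte_fin ltrN2 ltr_pdivlMr // /logb => h.
by rewrite [ltLHS]psi_powR gt1_ltr_powRr // ltrNr.
Unshelve. all: by end_near. Qed.
End Exponents.

(** * Orbits with small values at the times m 2^k *)

Section SmallOrbits.
Variables (R : realType) (beta : R).
Hypothesis beta_gt1 : 1 < beta.

Let beta_gt0 : 0 < beta. Proof. exact: lt_trans beta_gt1. Qed.

(** The polynomial loss in [many_full] is absorbed by any exponent below 1, even
    after the letters are lengthened by one digit. *)
Lemma full_words_dimension (sigma : R) : sigma < 1 -> exists n (s : seq R),
  [/\ uniq s, forall a, a \in s -> full R beta n a &
      (beta ^+ n.+1) `^ sigma <= (size s)%:R].
Proof.
move=> sigma1; set d := 1 - sigma; have d0 : 0 < d by rewrite subr_gt0.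
have bd1 : 1 < beta `^ d by rewrite -(powRr0 beta) gt1_ltr_powRr.
have [n hn] := exprn_gt_linear R _ (2 * beta) bd1.
have [s [s_uniq s_full hs]] := many_full R _ beta_gt1 n.
exists n, s; split => //.
rewrite exprn_powR ?(ltW beta_gt0) // in hn.
set x := beta ^+ n.+1 in hn *.
have x0 : 0 < x by rewrite exprn_gt0.
have xE : x = x `^ sigma * x `^ d.
  rewrite -powRD ?(gt_eqF x0) ?implybT // /d addrC subrK powRr1 //; exact: ltW.
have xs0 : 0 < x `^ sigma by rewrite powR_gt0.
have hx : x <= 2 * beta * ((size s)%:R * n.+1%:R).
  by rewrite /x exprS mulrAC -mulrA [leLHS]mulrC mulrA ler_pM2r // mulrC.
have n0 : 0 < 2 * beta * n.+1%:R by rewrite !mulr_gt0.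
rewrite -(ler_pM2r n0); apply: (@le_trans _ _ x).
  by rewrite [leRHS]xE ler_pM2l.
by apply: (le_trans hx); rewrite mulrCA.
Qed.

Lemma free_count_forced Q K :
  (Q * K <= Q * free_count (forced Q) K + 2 * K)%N.
Proof.
have E : (free_count (forced Q) K + \sum_(0 <= j < K) forced Q j = K)%N.
  rewrite /free_count -big_split /= -[RHS]subn0 -[RHS]muln1 -sum_nat_const_nat.
  by apply: eq_bigr => j _; case: forced.
by rewrite -{1}E mulnDr leq_add2l; exact: sum_forced_le.
Qed.

(** The measure bound of the Cantor set. The letters are left endpoints of full
    intervals of order [n], used with the contraction ratio [rho = beta ^- n.+1]
    of words of length [n.+1]: the additional digit 0 creates the gap
    [beta ^- n - rho] between the cylinders of distinct letters. *)
Lemma hausdorff_measure_small_orbits (s : R) : 0 <= s < 1 ->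
  exists m Q : nat, [/\ (0 < m)%N, (0 < Q)%N & forall A : set R,
    (forall x, x \in `[0, 1] ->
      (forall k, iter (m * 2 ^ k) (beta_map beta) x <= beta ^- (m * (2 ^ k %/ Q))) ->
      A x) ->
    hausdorff_measure s A != 0%E].
Proof.
move=> /andP[s0 s1].
(* Three exponents s <= sigma < tau < 1: tau is reached by the number of letters,
   and Q is so large that forcing zeros costs less than tau - sigma. A positive
   Hoelder exponent sigma is needed even when s = 0. *)
pose sigma := (1 + s) / 2; pose tau := (1 + sigma) / 2.
have sigma0 : 0 < sigma by rewrite /sigma; lra.
have sigma1 : sigma < 1 by rewrite /sigma; lra.
have s_sigma : s <= sigma by rewrite /sigma; lra.
have tau1 : tau < 1 by rewrite /tau; lra.
have tau0 : 0 < tau by rewrite /tau; lra.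
have sigma_tau : 0 < tau - sigma by rewrite /tau; lra.
pose Q := (Num.truncn (2 / (tau - sigma))).+1.
have hQ : 2 < Q%:R * (tau - sigma) by rewrite -ltr_pdivrMr //; exact: truncnS_gt.
have [n [L [L_uniq L_full hL]]] := full_words_dimension _ tau1.
exists n.+1, Q; split=> // A hA.
pose rho := beta ^- n.+1; pose gap := beta ^- n - rho.
have bn0 : 0 < beta ^+ n by rewrite exprn_gt0.
have bS0 : 0 < beta ^+ n.+1 by rewrite exprn_gt0.
have bS1 : 1 < beta ^+ n.+1 by rewrite exprn_egt1.
have rho0 : 0 < rho by rewrite invr_gt0.
have rho1 : rho < 1 by rewrite invf_lt1.
have gap0 : 0 < gap by rewrite subr_gt0 ltf_pV2 ?posrE // ltr_eXn2l.
have L0 : (0 < size L)%N.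
  by rewrite -(ltr_nat R); apply: lt_le_trans hL; rewrite powR_gt0.
have full_letter a : a \in 0 :: L -> full R beta n a.
  by rewrite in_cons => /predU1P[->|/L_full //]; exact: full_zero.
pose c t k := letter R L (forced Q) t k.
have c_full t k : 0 <= t < 1 -> full R beta n (c t k).
  by move=> tI; apply: full_letter; exact: letter_mem.
have ex_tails t : exists y : nat -> R, 0 <= t < 1 ->
    forall k, 0 <= y k <= 1 /\ y k = c t k + rho * y k.+1.
  have [tI|nt] := boolP (0 <= t < 1); last by exists (fun=> 0).
  have [y hy] : exists y : nat -> R, forall k, 0 <= y k <= 1 /\ y k = c t k + rho * y k.+1.
    apply: radix_tails; first by rewrite rho1 ltW.
    move=> k; have /andP[-> h] := full_itv _ _ beta_gt1 _ _ (c_full t k tI).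
    by apply: (le_trans h); move: gap0; rewrite /gap; lra.
  by exists y.
have [x hx] := choice ex_tails.
have x01 t k : 0 <= t < 1 -> 0 <= x t k <= 1 by move=> tI; case: (hx t tI k).
have xE t k : 0 <= t < 1 -> x t k = c t k + rho * x t k.+1.
  by move=> tI; case: (hx t tI k).
have x_lt1 t k : 0 <= t < 1 -> 0 <= x t k < 1.
  move=> tI; have /andP[-> _] := x01 t k tI; rewrite xE //=.
  have /andP[_ h] := full_itv _ _ beta_gt1 _ _ (c_full t k tI).
  have /andP[_ h'] := x01 t k.+1 tI.
  have : rho * x t k.+1 <= rho by rewrite ler_piMr // ltW.
  by move: gap0; rewrite /gap; lra.
(* The shift on letters is the n.+1-st iterate of the transformation. *)
have orbit t k : 0 <= t < 1 -> iter (n.+1 * k) (beta_map beta) (x t 0%N) = x t k.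
  move=> tI; elim: k => [|k IH]; first by rewrite muln0.
  rewrite mulnS iterD IH xE // mulrC.
  have fS : full R beta (n + 1) (c t k) by apply: full_widen => //; exact: c_full.
  by rewrite addn1 in fS; have [] := fS _ (x_lt1 t k.+1 tI).
have small t k : 0 <= t < 1 -> x t (2 ^ k)%N <= rho ^+ (2 ^ k %/ Q).
  move=> tI; suff : forall i, (i <= 2 ^ k %/ Q)%N -> x t (2 ^ k)%N = rho ^+ i * x t (2 ^ k + i)%N.
    move=> /(_ _ (leqnn _)) ->; rewrite ler_piMr ?exprn_ge0 ?(ltW rho0) //.
    by have /andP[] := x01 t (2 ^ k + 2 ^ k %/ Q)%N tI.
  elim=> [|i IH] iQ; first by rewrite expr0 mul1r addn0.
  rewrite IH ?(ltnW iQ) // xE // /c /letter forced_block // add0r addnS exprSr mulrA.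
  by [].
have hfree K : 1 <= (rho `^ sigma) ^+ K * (size L)%:R ^+ free_count (forced Q) K.
  set f := free_count _ _.
  rewrite exprn_powR ?(ltW rho0) //.
  have X0 : 0 <= beta ^+ n.+1 by exact: ltW.
  apply: (@le_trans _ _ ((rho ^+ K) `^ sigma * ((beta ^+ n.+1) `^ tau) ^+ f)); last first.
    by rewrite ler_wpM2l ?powR_ge0 // lerXn2r ?nnegrE ?powR_ge0.
  rewrite /rho exprVn -powR_inv1 ?exprn_ge0 ?(ltW beta_gt0) //.
  rewrite -powRrM mulN1r -(powR_mulrn K X0) -(powR_mulrn f (powR_ge0 _ _)) -!powRrM.
  rewrite -powRD; last by rewrite (gt_eqF bS0) implybT.
  rewrite -[leLHS](powRr0 (beta ^+ n.+1)) ler_powR ?(ltW bS1) //.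
  have : (Q * K)%:R <= (Q * f + 2 * K)%:R :> R by rewrite ler_nat free_count_forced.
  rewrite natrD !natrM => hf.
  have K0 : 0 <= K%:R :> R by [].
  have Q0 : 0 < Q%:R :> R by rewrite ltr0n.
  rewrite -(pmulr_rge0 _ Q0).
  (* The exponent Q * (tau * f - sigma * K) is the sum of the left sides of h1
     and h2 and of twice the left side of h3. *)
  have h1 : 0 <= (Q%:R * (tau - sigma) - 2) * K%:R by rewrite mulr_ge0 // subr_ge0 ltW.
  have h2 : 0 <= tau * (Q%:R * f%:R + 2 * K%:R - Q%:R * K%:R).
    by rewrite mulr_ge0 ?(ltW tau0) // subr_ge0.
  have h3 : 0 <= (1 - tau) * K%:R by rewrite mulr_ge0 // subr_ge0 ltW.
  nra.
apply: (@holder_parametrization_hausdorff_measure R A (fun t => x t 0%N) s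
   (gap `^ sigma)^-1) => //.
- by rewrite invr_gt0 powR_gt0.
- move=> t tI; apply: hA.
    by rewrite in_itv /= x01.
  by move=> k; rewrite orbit //; apply: (le_trans (small t k tI)); rewrite exprM exprVn.
move=> t u tI uI.
have gap_rho : gap + rho = beta ^- n by rewrite /gap subrK.
have := @coding_holder R L (forced Q) L_uniq L0 rho gap sigma x t u.
rewrite rho0 rho1 => /(_ isT gap0 sigma0 _ x01 xE hfree tI uI) h.
apply: (le_trans (h _)).
  move=> a b /full_letter fa /full_letter fb ab.
  by rewrite gap_rho; exact: full_separated.
rewrite ler_pM2l ?invr_gt0 ?powR_gt0 //.
have /andP[? ?] := x01 t 0%N tI; have /andP[? ?] := x01 u 0%N uI.
have D1 : `|x t 0%N - x u 0%N| <= 1 by rewrite ler_norml; apply/andP; split; lra.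
have := normr_ge0 (x t 0%N - x u 0%N); rewrite le_eqVlt => /predU1P[<-|D0].
  by rewrite powR0 ?powR_ge0 // gt_eqF.
by rewrite /powR gt_eqF // ler_expR ler_wnM2r // ln_le0.
Qed.
End SmallOrbits.

(** * The three cases *)

Lemma infinite_nat_unbounded (A : set nat) :
  infinite_set A <-> forall n0, exists2 n, (n0 <= n)%N & A n.
Proof.
split=> [infA n0|unbA finA].
  apply: contrapT => nA; apply: infA; apply: (sub_finite_set (B := `I_n0)).
    move=> n An /=; rewrite ltnNge; apply/negP => n0n; apply: nA.
    by exists n.
  exact: finite_II.
have [B AB] : exists B : nat, forall n, A n -> (n <= B)%N.
  move/finite_seqP: finA => [s ->].
  exists (\max_(i <- s) i)%N => n /= ns; exact: leq_bigmax_seq.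
by have [n Bn /AB] := unbA B.+1; rewrite leqNgt Bn.
Qed.

Lemma hausdorff_dim_ge0 (R : realType) (A : set R) : (0 <= hausdorff_dim A)%E.
Proof. by apply: le_ereal_inf_tmp => _ [s [s0 _] <-]; rewrite lee_fin. Qed.

Lemma hausdorff_dim_le (R : realType) (A : set R) (r : R) : 0 <= r ->
  (forall s, r < s -> hausdorff_measure s A = 0%E) -> (hausdorff_dim A <= r%:E)%E.
Proof.
move=> r0 hA; apply/lee_addgt0Pr => e e0.
apply: ereal_inf_lbound; exists (r + e) => //; split; first by rewrite addr_ge0 // ltW.
by apply: hA; rewrite ltrDl.
Qed.

Section ThreeCases.
Variables (R : realType) (beta : R) (psi1 psi2 : nat -> R).
Hypothesis beta_gt1 : 1 < beta.
Hypothesis psi1_gt0 : forall n, 0 < psi1 n.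
Hypothesis psi2_gt0 : forall n, 0 < psi2 n.

Let beta_gt0 : 0 < beta. Proof. exact: lt_trans beta_gt1. Qed.

(** A value at most [beta ^- (m * (2 ^ k %/ Q))] at time [m * 2 ^ k] is below
    [beta `^ (- (e * N))] for every [N <= m * 2 ^ k.+1], with [e = 1 / (4 * Q)].
    One factor 2 in [e] comes from the length of the dyadic block of times, the
    other from rounding [2 ^ k %/ Q]. *)
Lemma hausdorff_dim_subexponential :
  upper_exponent beta psi1 = 0%E -> upper_exponent beta psi2 = 0%E ->
  hausdorff_dim (limsup_set beta psi1 `&` uniform_set beta psi2) = 1%E.
Proof.
move=> u1 u2; apply/eqP; rewrite eq_le; apply/andP; split.
  apply: hausdorff_dim_le => // s s1; apply: hausdorff_measure_unit_eq0 => //.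
  by move=> x [[xI _] _].
apply: le_ereal_inf_tmp => _ [s [s0 Hs] <-]; rewrite lee_fin leNgt; apply/negP => s1.
have sI : 0 <= s < 1 by rewrite s0.
have [m [Q [m0 Q0 hmQ]]] := hausdorff_measure_small_orbits R beta beta_gt1 s sI.
suff /eqP : hausdorff_measure s (limsup_set beta psi1 `&` uniform_set beta psi2) != 0%E.
  by rewrite Hs.
apply: hmQ => x xI hx {s s0 Hs s1 sI}.
pose e : R := (4 * Q%:R)^-1.
have Q0R : 0 < Q%:R :> R by rewrite ltr0n.
have e0 : 0 < e by rewrite invr_gt0 mulr_gt0.
have block k : (Q <= 2 ^ k)%N ->
    iter (m * 2 ^ k) (beta_map beta) x <= beta `^ (- (e * (m * 2 ^ k.+1)%:R)).
  move=> Qk; apply: (le_trans (hx k)).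
  rewrite powRN -[beta ^+ _]powR_mulrn ?(ltW beta_gt0) //.
  rewrite lef_pV2 ?posrE ?powR_gt0 // ler_powR ?(ltW beta_gt1) //.
  rewrite !natrM mulrCA ler_wpM2l // /e.
  rewrite ler_pdivrMl ?mulr_gt0 // -!natrM ler_nat.
  have := divn_eq (2 ^ k) Q; have := ltn_pmod (2 ^ k) Q0.
  have : (0 < 2 ^ k %/ Q)%N by rewrite divn_gt0.
  rewrite expnS; set q := (_ %/ _)%N; set r := (_ %% _)%N.
  by clear -Q; move: (2 ^ k)%N => P q0 rQ ->; nia.
split; split => //.
  apply/infinite_nat_unbounded => n0.
  have [n1 _ hn1] := upper_exponent0_gt R beta psi1 beta_gt1 psi1_gt0 e u1 e0.
  pose k := (n0 + n1 + Q)%N; have k2 : (k < 2 ^ k)%N by exact: ltn_expl.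
  have mk : (2 ^ k <= m * 2 ^ k)%N by rewrite leq_pmull.
  exists (m * 2 ^ k)%N; first by clear -k2 mk; lia.
  have h := block k.
  apply: (le_lt_trans (h _)); first by clear -k2; lia.
  apply: le_lt_trans (hn1 (m * 2 ^ k)%N _); last by rewrite /=; clear -k2 mk; lia.
  rewrite ler_powR ?(ltW beta_gt1) // lerN2 ler_pM2l // ler_nat leq_pmul2l //.
  by rewrite leq_exp2l.
have [n1 _ hn1] := upper_exponent0_gt R beta psi2 beta_gt1 psi2_gt0 e u2 e0.
exists (n1 + m * (2 * Q))%N => // N /= hN.
have mQ : (2 * Q <= N %/ m)%N by rewrite leq_divRL // mulnC; clear -hN; lia.
have Nm0 : (0 < N %/ m)%N by apply: leq_trans mQ; rewrite muln_gt0.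
have /andP[k1 k2] := trunc_log_bounds (isT : (1 < 2)%N) Nm0.
set k := trunc_log 2 (N %/ m) in k1 k2.
have Qk : (Q <= 2 ^ k)%N by move: k2; rewrite expnS; clear -mQ; lia.
exists (m * 2 ^ k)%N.
  by apply: leq_trans (leq_trunc_div N m); rewrite mulnC leq_mul2r k1 orbT.
apply: (le_lt_trans (block k Qk)).
apply: le_lt_trans (hn1 N _); last by rewrite /=; clear -hN; lia.
rewrite ler_powR ?(ltW beta_gt1) // lerN2 ler_pM2l // ler_nat.
apply: ltnW; apply: (leq_trans (ltn_ceil N m0)).
by rewrite mulnC leq_mul2l k2 orbT.
Qed.

Lemma countable_fast_uniform : lower_exponent beta psi2 = +oo%E ->
  countable (limsup_set beta psi1 `&` uniform_set beta psi2).
Proof.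
move=> loo.
have cU : countable (uniform_set beta psi2).
  apply: countable_uniform_set => //.
  apply: filterS (lower_exponent_pinfty_lt R beta psi2 beta_gt1 psi2_gt0 3 loo) => n.
  by rewrite powRN -natrM powR_mulrn // ltW.
by apply: sub_countable cU; apply: subset_card_le => x [].
Qed.

(** At time [n] the cover consists of at most [M ^ n] intervals of length
    [beta ^- (L * n)]; the integer [L] is chosen with
    [(beta `^ s) ^+ L > 4 * M], so that their total cost is at most [4 ^- n].
    One factor [2 ^- n] makes the series converge, the other makes its tail
    small. *)
Lemma hausdorff_dim_fast_limsup : lower_exponent beta psi1 = +oo%E ->
  hausdorff_dim (limsup_set beta psi1 `&` uniform_set beta psi2) = 0%E.
Proof.
move=> loo; apply/eqP; rewrite eq_le hausdorff_dim_ge0 andbT.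
apply: hausdorff_dim_le => // s s0; apply: hausdorff_measure_eq0 => // e e0.
pose M := (Num.truncn beta).+1.
have bs1 : 1 < beta `^ s by rewrite -(powRr0 beta) gt1_ltr_powRr.
have [L hL] := exprn_unbounded R _ (4 * M%:R) bs1.
have L0 : (0 < L)%N.
  case: L hL => //; rewrite expr0 ltNge => /negP[].
  have : 1 <= M%:R :> R by rewrite ler1n.
  by lra.
have [n1 _ hn1] := lower_exponent_pinfty_lt R beta psi1 beta_gt1 psi1_gt0 L%:R loo.
have two1 : 1 < 2 :> R by rewrite ltr1n.
have [n2 hn2] := exprn_unbounded R 2 (2 / e) two1.
have [n3 hn3] := exprn_unbounded R beta e^-1 beta_gt1.
pose n0 := maxn n1 (maxn n2 n3).
pose d n : R := if (n0 <= n)%N then beta ^- (L * n) else 0.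
pose p n j := nth 0 (zero_preimages R beta n) j.
exists (fun n => if (n0 <= n)%N then M ^ n else 0)%N, d,
  (fun n j => [set` `[p n j, p n j + d n]]).
have d0 n : 0 <= d n by rewrite /d; case: ifP => // _; rewrite invr_ge0 exprn_ge0 // ltW.
split.
- move=> n; rewrite d0 /= /d; case: ifP => [nn|_]; last exact: ltW.
  rewrite -[leRHS]invrK lef_pV2 ?posrE ?invr_gt0 ?exprn_gt0 //.
  apply: (le_trans (ltW hn3)); rewrite ler_eXn2l //.
  apply: (@leq_trans n); last by rewrite leq_pmull.
  by move: nn; rewrite !geq_max => /and3P[].
- move=> n j _; apply: diam_le => // x y /=; rewrite !in_itv /=.
  move=> /andP[x0 x1] /andP[y0 y1].
  by rewrite ler_norml; apply/andP; split; lra.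
- move=> n; rewrite /d; case: ifP => [nn|_]; last first.
    by rewrite mul0r divr_ge0 // ltW.
  have n2n : (n2 <= n)%N by move: nn; rewrite !geq_max => /and3P[].
  have X0 : 0 < beta `^ s by rewrite powR_gt0.
  have -> : (beta ^- (L * n)) `^ s = ((beta `^ s) ^+ L) ^- n.
    rewrite -exprM exprn_powR ?(ltW beta_gt0) //.
    by rewrite -powR_inv1 ?exprn_ge0 ?(ltW beta_gt0) // -powRrM mulN1r powRN.
  have M0 : 0 < M%:R :> R by [].
  rewrite natrX ler_pdivrMr ?exprn_gt0 ?exprn_gt0 //.
  apply: (@le_trans _ _ (e / (2 ^ n.+1)%:R * (4 * M%:R) ^+ n)); last first.
    rewrite ler_wpM2l ?divr_ge0 ?(ltW e0) //.
    by rewrite lerXn2r ?nnegrE ?exprn_ge0 ?mulr_ge0 ?(ltW X0) ?(ltW hL).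
  rewrite exprMn mulrA ler_peMl ?exprn_ge0 //.
  rewrite mulrAC ler_pdivlMr // mul1r.
  have -> : (4 : R) = 2 * 2 by rewrite -natrM.
  rewrite natrX exprS exprMn mulrA ler_pM2r ?exprn_gt0 //.
  rewrite mulrC -ler_pdivrMr //; apply: (le_trans (ltW hn2)).
  by rewrite ler_eXn2l.
move=> x [[xI /infinite_nat_unbounded hx] _].
have [n nn hn] := hx n0.
have [q qn Eq] := zero_preimagesP R beta beta_gt1 n x xI.
exists n => //; exists (index q (zero_preimages R beta n)).
  by rewrite /= nn -size_zero_preimages // index_mem.
rewrite /= in_itv /= /p nth_index // /d nn.
have /andP[T0 _] := iter_beta_map_itv R beta n x xI.
have n1n : (n1 <= n)%N by move: nn; rewrite !geq_max => /andP[].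
have hd : iter n (beta_map beta) x <= beta ^- (L * n).
  rewrite ltW //; apply: (lt_trans hn); apply: lt_le_trans (hn1 n n1n) _.
  by rewrite powRN -natrM powR_mulrn // ltW.
have hb : iter n (beta_map beta) x / beta ^+ n <= iter n (beta_map beta) x.
  by rewrite ler_pdivrMr ?exprn_gt0 // ler_peMr // exprn_ege1 // ltW.
have hb0 : 0 <= iter n (beta_map beta) x / beta ^+ n.
  by rewrite divr_ge0 // exprn_ge0 // ltW.
apply/andP; split; first by rewrite [leRHS]Eq lerDl.
by rewrite [leLHS]Eq lerD2l (le_trans hb).
Qed.
End ThreeCases.

Theorem theorem1 (R : realType) (beta : R) (psi1 psi2 : nat -> R)
  (hbeta : 1 < beta)
  (hpsi1 : forall n, 0 < psi1 n) (hpsi2 : forall n, 0 < psi2 n)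
  (hv1 : (0 <= lower_exponent beta psi1)%E)
  (hv2 : (0 <= lower_exponent beta psi2)%E) :
  [/\ (lower_exponent beta psi1 = 0%E -> upper_exponent beta psi1 = 0%E ->
       lower_exponent beta psi2 = 0%E -> upper_exponent beta psi2 = 0%E ->
       hausdorff_dim (limsup_set beta psi1 `&` uniform_set beta psi2) = 1%E),
      (lower_exponent beta psi2 = +oo%E ->
       (0 <= lower_exponent beta psi1)%E ->
       (lower_exponent beta psi1 <= upper_exponent beta psi1)%E ->
       (upper_exponent beta psi1 <= +oo)%E ->
       countable (limsup_set beta psi1 `&` uniform_set beta psi2)) &
      (lower_exponent beta psi1 = +oo%E ->
       (0 <= lower_exponent beta psi2)%E ->
       (lower_exponent beta psi2 <= upper_exponent beta psi2)%E ->
       (upper_exponent beta psi2 <= +oo)%E ->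
       hausdorff_dim (limsup_set beta psi1 `&` uniform_set beta psi2) = 0%E)].
Proof.
split=> [_ u1 _ u2|loo _ _ _|loo _ _ _].
- exact: hausdorff_dim_subexponential.
- exact: countable_fast_uniform.
- exact: hausdorff_dim_fast_limsup.
Qed.
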